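(* Let $n\ge1$, $\mathbf x\in\mathbb R^n$, $\mathbf X\in\mathbb R^{n\times n}$ and $\mathbf z\in[0,1]^n$. Then the infinite family of inequalities consisting of $\mathbf X\succeq\mathbf x\mathbf x^\top$ together with $$\langle\mathbf d\mathbf d^\top,\mathbf X\rangle\ \ge\ \frac{(\mathbf d^\top\mathbf x)_+^2}{\min\{1,\sum_{i=1}^n z_i\}}+\frac{(\mathbf d^\top\mathbf x)_-^2}{\min\{1,\sum_{i=1}^n(1-z_i)\}}\qquad\text{for all }\mathbf d\in\mathbb R_+^n$$ holds if and only if $\mathbf X\succeq\mathbf x\mathbf x^\top$ and the two copositive constraints $$\begin{pmatrix}\sum_{i=1}^n z_i&-\mathbf x^\top\\-\mathbf x&\mathbf X\end{pmatrix}\in\mathcal C_+^{n+1}\quad\text{and}\quad\begin{pmatrix}\sum_{i=1}^n(1-z_i)&\mathbf x^\top\\\mathbf x&\mathbf X\end{pmatrix}\in\mathcal C_+^{n+1}$$ hold.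
   Context: $\mathcal C_+^m=\{\mathbf Y\in\mathbb R^{m\times m}:\mathbf Y=\mathbf Y^\top,\ \mathbf v^\top\mathbf Y\mathbf v\ge0\ \forall\mathbf v\in\mathbb R_+^m\}$ is the cone of copositive matrices. $\mathbf X\succeq\mathbf x\mathbf x^\top$ means that $\mathbf X-\mathbf x\mathbf x^\top$ is symmetric positive semidefinite. $\langle\mathbf A,\mathbf B\rangle=\sum_{i,j}A_{ij}B_{ij}$. For $c\in\mathbb R$, $(c)_+=\max\{c,0\}$, $(c)_-=\min\{c,0\}$, and $(c)_\pm^2$ is the square of $(c)_\pm$. Convention: $0/0=0$, and $a/0=+\infty$ for $a>0$. *)

(* Defs.v *)
From mathcomp Require Export all_boot all_order all_algebra.
From mathcomp Require Export classical_sets reals constructive_ereal.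

Set Implicit Arguments.
Unset Strict Implicit.
Unset Printing Implicit Defensive.

Import Order.TTheory GRing.Theory Num.Theory.
Local Open Scope classical_set_scope.
Local Open Scope ring_scope.

Section Definitions.
Variable R : realType.

(* The 1 x 1 products d^T x and v^T Y v, read as scalars. *)
Definition dotp n (u v : 'cV[R]_n) : R := (u^T *m v) 0 0.
Definition qform n (Y : 'M[R]_n) (v : 'cV[R]_n) : R := (v^T *m Y *m v) 0 0.

Definition mx_inner m n (A B : 'M[R]_(m, n)) : R :=
  \sum_i \sum_j A i j * B i j.

Definition nonneg_cone n : set 'cV[R]_n := [set v | forall i, 0 <= v i 0].

Definition copositive_cone m : set 'M[R]_m :=
  [set Y | Y = Y^T /\ forall v, nonneg_cone v -> 0 <= qform Y v].

Definition psd_cone m : set 'M[R]_m :=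
  [set Y | Y = Y^T /\ forall v, 0 <= qform Y v].

Definition loewner_ge m (A B : 'M[R]_m) : Prop := psd_cone (A - B).

Definition pos_part (c : R) : R := Num.max c 0.
Definition neg_part (c : R) : R := Num.min c 0.

(* Division is the one of \bar R, where 0^-1 = +oo and 0 * +oo = 0; hence
   0 / 0 = 0 and a / 0 = +oo for a > 0. *)
Definition family_rhs n (x z d : 'cV[R]_n) : \bar R :=
  ((pos_part (dotp d x) ^+ 2)%:E / (Num.min 1 (\sum_i z i 0))%:E
   + (neg_part (dotp d x) ^+ 2)%:E / (Num.min 1 (\sum_i (1 - z i 0)))%:E)%E.

End Definitions.

(* Main.v *)
(* For d >= 0, copositivity of the first matrix says that the quadratic
   s w^2 - 2 w (d^T x) + <dd^T, X> in w, with s the sum of the z_i, is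
   nonnegative on w >= 0. Minimizing over w, this means
   <dd^T, X> >= (d^T x)_+^2 / s; the version with min {1, s} follows because
   X >= xx^T already gives <dd^T, X> >= (d^T x)^2. The second matrix
   accounts for (d^T x)_- in the same way. *)
Require Import Defs.
From mathcomp Require Import ring lra.
Import Order.TTheory GRing.Theory Num.Theory.
Local Open Scope ring_scope.

Section CopositiveSplit.
Variable R : realType.
Implicit Types (c q s t : R) (n : nat).

(** Turning (c)_- into (- c)_+ lets one result on positive parts serve both summands. *)
Lemma neg_part_sqr c : neg_part c ^+ 2 = pos_part (- c) ^+ 2.
Proof. by rewrite /neg_part /pos_part -sqrrN -{2}oppr0 oppr_min. Qed.

(* If [s = 0 < c], the division is [+oo] and the affine function of [w] on the
   right is negative at [w = (q + 1) / c]. *)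
Lemma perspective_le s c q : 0 <= s -> c ^+ 2 <= q ->
  ((pos_part c ^+ 2)%:E / (Num.min 1 s)%:E <= q%:E)%E <->
  (forall w, 0 <= w -> 0 <= s * w ^+ 2 - w * c *+ 2 + q).
Proof.
move=> s0 cq; have q0 : 0 <= q by apply: le_trans cq; exact: sqr_ge0.
have [c_le0|c_gt0] := leP c 0.
  (* For c <= 0 both sides hold: the quotient is 0, and s w^2, - 2 w c and q are all nonnegative. *)
  rewrite /pos_part max_r // expr0n /= mul0e lee_fin; split => // _ w w0.
  by have := mulr_ge0 s0 (sqr_ge0 w); nra.
rewrite /pos_part max_l; last exact: ltW.
have [s_eq0|s_neq0] := eqVneq s 0.
  rewrite s_eq0 min_r ?ler01 // inver eqxx gt0_muley ?lte_fin ?exprn_gt0 //.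
  split=> [|h]; first by rewrite leye_eq.
  have w0 : 0 <= (q + 1) / c by rewrite divr_ge0 ?addr_ge0 ?ler01 // ltW.
  by exfalso; have := h _ w0; rewrite mul0r divfK ?gt_eqF //; lra.
have s_gt0 : 0 < s by rewrite lt_neqAle eq_sym s_neq0.
have m_gt0 : 0 < Num.min 1 s by rewrite lt_min ltr01.
rewrite inver gt_eqF // -EFinM lee_fin ler_pdivrMr //.
(* Since q min {1, s} = min {q, q s}, the assumption c^2 <= q removes the 1. *)
have -> : (c ^+ 2 <= q * Num.min 1 s) = (c ^+ 2 <= q * s).
  rewrite minr_pMr // mulr1 le_min cq //.
(* Multiplied by s, the quadratic is (s w - c)^2 + (q s - c^2); its minimizer is w = c / s. *)
split=> [h w w0|/(_ (c / s) (divr_ge0 (ltW c_gt0) s0))].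
  rewrite -(pmulr_rge0 _ s_gt0).
  by have := sqr_ge0 (s * w - c); nra.
have -> : s * (c / s) ^+ 2 - c / s * c *+ 2 + q = (q * s - c ^+ 2) / s.
  by field.
by rewrite pmulr_lge0 ?invr_gt0 // subr_ge0.
Qed.

(* At least one of the two summands on the left vanishes. *)
Lemma perspective_add_le s t c q : 0 <= s -> 0 <= t -> 0 <= q ->
  ((pos_part c ^+ 2)%:E / (Num.min 1 s)%:E +
     (neg_part c ^+ 2)%:E / (Num.min 1 t)%:E <= q%:E)%E <->
  ((pos_part c ^+ 2)%:E / (Num.min 1 s)%:E <= q%:E)%E /\
  ((pos_part (- c) ^+ 2)%:E / (Num.min 1 t)%:E <= q%:E)%E.
Proof.
move=> s0 t0 q0; rewrite neg_part_sqr /pos_part.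
have [c0|/ltW c0] := leP c 0.
  (* The inequality whose numerator is zero reads 0 <= q. *)
  by rewrite expr0n /= !mul0e add0e lee_fin; split=> [|[]].
by rewrite (max_r (x := - c)) ?oppr_le0 // expr0n /= !mul0e adde0 lee_fin;
  split=> [|[]].
Qed.

Lemma dotpNr n (u v : 'cV[R]_n) : dotp u (- v) = - dotp u v.
Proof. by rewrite /dotp mulmxN mxE. Qed.

Lemma dotpC n (u v : 'cV[R]_n) : dotp u v = dotp v u.
Proof.
by rewrite /dotp -[LHS]trace_mx11 -mxtrace_tr trmx_mul trmxK trace_mx11.
Qed.

Lemma qform_outer n (x d : 'cV[R]_n) : qform (x *m x^T) d = dotp d x ^+ 2.
Proof.
rewrite /qform mulmxA -mulmxA mxE big_ord1 expr2; congr (_ * _).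
exact: dotpC.
Qed.

Lemma qformB n (A B : 'M[R]_n) d : qform (A - B) d = qform A d - qform B d.
Proof. by rewrite /qform mulmxBr mulmxBl !mxE. Qed.

Lemma mx_inner_outer n (X : 'M[R]_n) d : mx_inner (d *m d^T) X = qform X d.
Proof.
rewrite /mx_inner /qform -mulmxA mxE; apply: eq_bigr => i _.
rewrite !mxE mulr_sumr; apply: eq_bigr => j _.
by rewrite !mxE big_ord1 !mxE; ring.
Qed.

Lemma qform_block n s (y d : 'cV[R]_n) (X : 'M[R]_n) (w : 'cV[R]_1) :
  qform (block_mx s%:M y^T y X) (col_mx w d) =
  s * w 0 0 ^+ 2 + w 0 0 * dotp d y *+ 2 + qform X d.
Proof.
rewrite /qform tr_col_mx mul_row_block mul_row_col !mulmxDl.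
rewrite mul_mx_scalar [w]mx11_scalar tr_scalar_mx !mul_scalar_mx !mul_mx_scalar.
rewrite !mxE eqxx mulr1n -/(dotp _ _).
have -> : \sum_j (w 0 0 *: y^T) 0 j * d j 0 = w 0 0 * dotp d y.
  by rewrite dotpC /dotp mxE mulr_sumr; apply: eq_bigr => j _; rewrite !mxE mulrA.
by rewrite /dotp !mxE; ring.
Qed.

(** A vector of dimension 1 + n is a scalar [w] stacked on some [d], and it is nonnegative exactly
    when both are; the block matrix inherits its symmetry from [X]. *)
Lemma copositive_block n s (y : 'cV[R]_n) (X : 'M[R]_n) : X = X^T ->
  copositive_cone (block_mx s%:M y^T y X) <->
  (forall d w, nonneg_cone d -> 0 <= w ->
     0 <= s * w ^+ 2 + w * dotp d y *+ 2 + qform X d).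
Proof.
move=> symX; split=> [[_ h] d w d0 w0|h].
  have := h (col_mx w%:M d); rewrite qform_block mxE eqxx mulr1n; apply=> i.
  by case: (split_ordP i) => j ->; rewrite ?col_mxEu ?col_mxEd // ord1 mxE eqxx.
split=> [|v v0]; first by rewrite tr_block_mx tr_scalar_mx trmxK -symX.
rewrite -[v]vsubmxK qform_block; apply: h => [i|].
  by rewrite mxE; exact: v0.
by rewrite mxE; exact: v0.
Qed.

End CopositiveSplit.

Theorem proposition7 (R : realType) (n : nat) (hn : (1 <= n)%N)
    (x : 'cV[R]_n) (X : 'M[R]_n) (z : 'cV[R]_n)
    (hz : forall i : 'I_n, 0 <= z i 0 <= 1) :
  (loewner_ge X (x *m x^T) /\
   (forall d : 'cV[R]_n, nonneg_cone d ->
      (family_rhs x z d <= (mx_inner (d *m d^T) X)%:E)%E))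
  <->
  (loewner_ge X (x *m x^T) /\
   copositive_cone (block_mx (\sum_i z i 0)%:M (- x^T) (- x) X) /\
   copositive_cone (block_mx (\sum_i (1 - z i 0))%:M x^T x X)).
Proof.
have s0 : 0 <= \sum_i z i 0 by apply: sumr_ge0 => i _; case/andP: (hz i).
have t0 : 0 <= \sum_i (1 - z i 0).
  by apply: sumr_ge0 => i _; rewrite subr_ge0; case/andP: (hz i).
(* Both matrices now fit [copositive_block], with [y] equal to [- x] and to [x]. *)
have -> : - x^T = (- x)^T by rewrite raddfN.
suff equiv : loewner_ge X (x *m x^T) ->
    (forall d, nonneg_cone d ->
       (family_rhs x z d <= (mx_inner (d *m d^T) X)%:E)%E) <->
    copositive_cone (block_mx (\sum_i z i 0)%:M (- x)^T (- x) X) /\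
    copositive_cone (block_mx (\sum_i (1 - z i 0))%:M x^T x X).
  by split=> -[psdX /(equiv psdX)].
move=> -[symXx psdXx].
(* As [x *m x^T] is symmetric, [X] inherits the symmetry of the difference. *)
have symX : X = X^T.
  move: symXx; rewrite linearB /= trmx_mul trmxK => /eqP.
  by rewrite (inj_eq (addIr _)) => /eqP.
(* This supplies the hypothesis [c ^+ 2 <= q] of [perspective_le], for c = d^T x and for its
   opposite. *)
have c2_le d : dotp d x ^+ 2 <= qform X d.
  by have := psdXx d; rewrite qformB qform_outer subr_ge0.
have q0 d : 0 <= qform X d by apply: le_trans (c2_le d); exact: sqr_ge0.
have famP d : (family_rhs x z d <= (mx_inner (d *m d^T) X)%:E)%E <->
    (forall w, 0 <= w ->
       0 <= (\sum_i z i 0) * w ^+ 2 + w * dotp d (- x) *+ 2 + qform X d) /\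
    (forall w, 0 <= w ->
       0 <= (\sum_i (1 - z i 0)) * w ^+ 2 + w * dotp d x *+ 2 + qform X d).
  rewrite mx_inner_outer /family_rhs perspective_add_le // !perspective_le //.
    by rewrite dotpNr; split=> -[h1 h2]; split=> w w0;
      move: (h1 w w0) (h2 w w0); rewrite !mulrN mulNrn ?opprK.
  by rewrite sqrrN.
(* Copositivity quantifies over [d] and [w] jointly, so it remains to apply [famP] at each [d]. *)
rewrite !copositive_block //; split=> [h|[h1 h2] d d0].
  by split=> d w d0 w0; have [h1 h2] := (famP d).1 (h d d0); [exact: h1|exact: h2].
by apply/famP; split=> w w0; [exact: h1|exact: h2].
Qed.
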